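(* Consider NEAR-DGD$^+$: $\mathbf{x}_k=\mathbf{Z}^{t(k)}\mathbf{y}_k$, $\mathbf{y}_{k+1}=\mathbf{x}_k-\alpha\nabla\mathbf{f}(\mathbf{x}_k)$, $k=0,1,2,\ldots$, for a sequence of nonnegative integers $t(k)$, started from a common point $y_{i,0}=s_0$. Suppose each $f_i$ is $\mu_i$-strongly convex with $L_i$-Lipschitz gradient, $x^\star$ is the minimizer of $h=\sum_if_i$, and $0<\alpha\le\min\{1/L,c_4\}$. Then for every $\delta>0$ and all $k=0,1,2,\ldots$, $$\|\bar x_{k+1}-x^\star\|^2\le c_1^2\|\bar x_k-x^\star\|^2+c_3^2\beta^{2t(k)},$$ with $c_1^2=1-\alpha c_2+\alpha\delta-\alpha^2\delta c_2$ and $c_3^2=\alpha(\alpha+\delta^{-1})D^2L^2$. Moreover, if $\alpha c_2<1$ and $\{t(k)\}$ is strictly increasing with $t(k)\to\infty$, then $\bar x_k\to x^\star$ and $x_{i,k}\to x^\star$ for every $i$.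
   Context: $\mathbf{Z}=\mathbf{W}\otimes I_p$ with $\mathbf{W}$ a symmetric doubly-stochastic $n\times n$ matrix of a connected network ($w_{ii}>0$, $w_{ij}>0$ iff neighbours), simple eigenvalue $1$, other eigenvalues in $(-1,1)$; $\beta\in(0,1)$ its second largest eigenvalue magnitude. $\mathbf{x}=(x_1;\ldots;x_n)$, $\nabla\mathbf{f}(\mathbf{x})=(\nabla f_1(x_1);\ldots;\nabla f_n(x_n))$, $\bar x_k=\frac1n\sum_ix_{i,k}$. Constants: $L=\max_iL_i$, $\mu_{\bar f}=\frac1n\sum_i\mu_i$, $L_{\bar f}=\frac1n\sum_iL_i$, $c_2=\frac{2\mu_{\bar f}L_{\bar f}}{\mu_{\bar f}+L_{\bar f}}$, $c_4=\frac{2}{\mu_{\bar f}+L_{\bar f}}$, $D=\|\mathbf{y}_0-\mathbf{u}^\star\|+\frac{\nu+4}{\nu}\|\mathbf{u}^\star\|$, $\mathbf{u}^\star=(\arg\min f_1;\ldots;\arg\min f_n)$, $\nu=2\alpha\min_i\frac{\mu_iL_i}{\mu_i+L_i}$. *)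

(* Defs.v *)
From mathcomp Require Import all_boot.
From Stdlib Require Import Reals Relations.
Set Implicit Arguments. Unset Strict Implicit.
Open Scope R_scope.

Definition vec (p : nat) := 'I_p -> R.

Definition rsum (n : nat) (F : 'I_n -> R) : R := \big[Rplus/0%R]_(i < n) F i.

Definition vadd p (x y : vec p) : vec p := fun j => x j + y j.
Definition vsub p (x y : vec p) : vec p := fun j => x j - y j.
Definition vscale p (a : R) (x : vec p) : vec p := fun j => a * x j.
Definition dot p (x y : vec p) : R := rsum (fun j => x j * y j).
Definition vnorm p (x : vec p) : R := sqrt (dot x x).

Definition stacked n p := 'I_n -> vec p.
Definition snorm n p (x : stacked n p) : R := sqrt (rsum (fun i => dot (x i) (x i))).

Definition avg n p (x : stacked n p) : vec p :=
  fun j => / INR n * rsum (fun i => x i j).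

(* max / min of finitely many reals indexed by 'I_n (0 if n = 0) *)
Definition maxR n (F : 'I_n -> R) : R :=
  match map F (enum 'I_n) with [::] => 0 | a :: s => foldr Rmax a s end.
Definition minR n (F : 'I_n -> R) : R :=
  match map F (enum 'I_n) with [::] => 0 | a :: s => foldr Rmin a s end.

(* Z = W (x) I_p acting on stacked vectors, and its powers *)
Definition Zmul n p (W : 'I_n -> 'I_n -> R) (y : stacked n p) : stacked n p :=
  fun i j => rsum (fun l => W i l * y l j).
Definition Zpow n p (W : 'I_n -> 'I_n -> R) (t : nat) (y : stacked n p) : stacked n p :=
  iter t (Zmul W) y.

Definition eigenvalue n (W : 'I_n -> 'I_n -> R) (lam : R) : Prop :=
  exists v : 'I_n -> R, (exists i, v i <> 0) /\
    forall i, rsum (fun l => W i l * v l) = lam * v i.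

Definition network_matrix n (W : 'I_n -> 'I_n -> R) : Prop :=
  (forall i j, W i j = W j i) /\
  (forall i j, 0 <= W i j) /\
  (forall i, rsum (fun j => W i j) = 1) /\
  (forall j, rsum (fun i => W i j) = 1) /\
  (forall i, 0 < W i i) /\
  (forall i j, clos_refl_trans _ (fun a b => 0 < W a b) i j) /\
  (* 1 is a simple eigenvalue: its eigenspace is spanned by the ones vector *)
  eigenvalue W 1 /\
  (forall v : 'I_n -> R, (forall i, rsum (fun l => W i l * v l) = v i) ->
      forall i j, v i = v j) /\
  (forall lam, eigenvalue W lam -> lam <> 1 -> -1 < lam < 1).

Definition is_SLEM n (W : 'I_n -> 'I_n -> R) (beta : R) : Prop :=
  (exists lam, eigenvalue W lam /\ lam <> 1 /\ Rabs lam = beta) /\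
  (forall lam, eigenvalue W lam -> lam <> 1 -> Rabs lam <= beta).

Definition has_gradient p (f : vec p -> R) (g : vec p -> vec p) : Prop :=
  forall x eps, 0 < eps -> exists delta, 0 < delta /\
    forall h : vec p, 0 < vnorm h < delta ->
      Rabs (f (vadd x h) - f x - dot (g x) h) <= eps * vnorm h.

Definition strongly_convex p (mu : R) (f : vec p -> R) : Prop :=
  0 < mu /\
  forall x y theta, 0 <= theta <= 1 ->
    f (vadd (vscale theta x) (vscale (1 - theta) y))
      <= theta * f x + (1 - theta) * f y
         - mu / 2 * theta * (1 - theta) * (vnorm (vsub x y)) ^ 2.

Definition lipschitz p (L : R) (g : vec p -> vec p) : Prop :=
  forall x y, vnorm (vsub (g x) (g y)) <= L * vnorm (vsub x y).

Definition is_minimizer p (f : vec p -> R) (x : vec p) : Prop :=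
  forall z, f x <= f z.

(* Main.v *)
From mathcomp Require Import all_boot all_algebra Rstruct.
From Stdlib Require Import Reals Lra Lia FunctionalExtensionality.
Require Import Defs.
Set Implicit Arguments. Unset Strict Implicit.
Delimit Scope ring_scope with ring.
Open Scope R_scope.

(** Averaging turns NEAR-DGD+ into an inexact gradient descent for the mean of
    the [f i]: the mean of the [x i] moves along the mean of the gradients
    taken at the local points instead of at the mean.  The exact gradient step
    contracts towards [xstar] by cocoercivity, and the gradient error is at
    most [L] times the consensus error, which mixing shrinks by [beta ^ t k]
    provided the iterates stay bounded.  They do: each local gradient step
    contracts towards [ustar] by a factor [1 - nu / 2], while mixing increases
    the distance to [ustar] by at most [2 |ustar|].

    That mixing shrinks the consensus error is the spectral norm bound for a
    symmetric matrix [A].  With [s] the supremum of [|A v|^2 / |v|^2], the form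
    [s - A^2] is positive semidefinite, and it is singular since otherwise it
    would be bounded away from 0; hence [sqrt s] or [- sqrt s] is an eigenvalue
    of [A]. *)

(** * Sums, inner products and norms *)

Lemma rsum_ext n (F G : 'I_n -> R) : (forall i, F i = G i) -> rsum F = rsum G.
Proof. by move=> FG; apply: eq_bigr => i _. Qed.

Lemma rsumD n (F G : 'I_n -> R) : rsum (fun i => F i + G i) = rsum F + rsum G.
Proof. exact: big_split. Qed.

Lemma rsumZ n a (F : 'I_n -> R) : rsum (fun i => a * F i) = a * rsum F.
Proof. by rewrite /rsum (@big_distrr _ 0 Rmult Rplus). Qed.

Lemma rsumB n (F G : 'I_n -> R) : rsum (fun i => F i - G i) = rsum F - rsum G.
Proof.
rewrite (rsum_ext (G := fun i => F i + (-1) * G i)); last by move=> i; ring.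
by rewrite rsumD rsumZ; ring.
Qed.

Lemma rsum_exchange n m (F : 'I_n -> 'I_m -> R) :
  rsum (fun i => rsum (F i)) = rsum (fun j => rsum (fun i => F i j)).
Proof. exact: exchange_big. Qed.

Lemma rsum_const n c : rsum (fun _ : 'I_n => c) = INR n * c.
Proof.
elim: n => [|n IHn]; first by rewrite /rsum big_ord0 /=; ring.
by rewrite S_INR; move: IHn; rewrite /rsum big_ord_recl => ->; ring.
Qed.

Lemma rsum_delta n (i : 'I_n) s (v : vec n) :
  rsum (fun l => (if i == l then s else 0) * v l) = s * v i.
Proof.
rewrite /rsum (bigD1 i) //= eqxx big1 ?Rplus_0_r // => l /negbTE.
by rewrite eq_sym => ->; ring.
Qed.

Lemma rsum_ge0 n (F : 'I_n -> R) : (forall i, 0 <= F i) -> 0 <= rsum F.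
Proof.
by move=> F0; rewrite /rsum; elim/big_ind: _ => // *; lra.
Qed.

Lemma rsum_le n (F G : 'I_n -> R) : (forall i, F i <= G i) -> rsum F <= rsum G.
Proof.
move=> FG; suff : 0 <= rsum (fun i => G i - F i) by rewrite rsumB; lra.
by apply: rsum_ge0 => i; move: (FG i); lra.
Qed.

Lemma rsum_ge_term n (F : 'I_n -> R) i : (forall i, 0 <= F i) -> F i <= rsum F.
Proof.
move=> F0; rewrite /rsum (bigD1 i) //=.
set r := bigop _ _ _; suff : 0 <= r by rewrite /=; lra.
by rewrite /r; elim/big_ind: _ => // *; lra.
Qed.

(** The anonymous argument of type ['I_n] encodes [0 < n]; later statements use the same device. *)
Lemma rsum_gt0 n (F : 'I_n -> R) : 'I_n -> (forall i, 0 < F i) -> 0 < rsum F.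
Proof.
move=> i F0; apply: Rlt_le_trans (rsum_ge_term i _); first exact: F0.
by move=> j; apply: Rlt_le.
Qed.

Section dot.
Variable p : nat.
Implicit Types x y z : vec p.

Lemma dotC x y : dot x y = dot y x.
Proof. by apply: rsum_ext => j; ring. Qed.

Lemma dotDl x y z : dot (vadd x y) z = dot x z + dot y z.
Proof. by rewrite /dot -rsumD; apply: rsum_ext => j; rewrite /vadd; ring. Qed.

Lemma dotBl x y z : dot (vsub x y) z = dot x z - dot y z.
Proof. by rewrite /dot -rsumB; apply: rsum_ext => j; rewrite /vsub; ring. Qed.

Lemma dotZl a x z : dot (vscale a x) z = a * dot x z.
Proof. by rewrite /dot -rsumZ; apply: rsum_ext => j; rewrite /vscale; ring. Qed.

Lemma dotDr x y z : dot z (vadd x y) = dot z x + dot z y.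
Proof. by rewrite dotC dotDl !(dotC z). Qed.

Lemma dotBr x y z : dot z (vsub x y) = dot z x - dot z y.
Proof. by rewrite dotC dotBl !(dotC z). Qed.

Lemma dotZr a x z : dot z (vscale a x) = a * dot z x.
Proof. by rewrite dotC dotZl (dotC z). Qed.

Definition dotE := (dotDl, dotBl, dotZl, dotDr, dotBr, dotZr).

Lemma dot_ge0 x : 0 <= dot x x.
Proof. by apply: rsum_ge0 => j; nra. Qed.

Lemma dot_le0_eq0 x : dot x x <= 0 -> forall j, x j = 0.
Proof.
move=> x0 j; have := @rsum_ge_term _ (fun j => x j * x j) j (fun j => Rle_0_sqr (x j)).
by rewrite -/(dot x x) => h; nra.
Qed.

Lemma dot_gt0 x j : x j <> 0 -> 0 < dot x x.
Proof.
by move=> xj; apply: Rnot_le_lt => /dot_le0_eq0 /(_ j).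
Qed.

Lemma dot_cauchy_schwarz x y : dot x y * dot x y <= dot x x * dot y y.
Proof.
have q a : 0 <= dot x x - 2 * a * dot x y + a * a * dot y y.
  have := dot_ge0 (vsub x (vscale a y)); rewrite !dotE (dotC y x); lra.
have [y0|y0] := Rle_lt_dec (dot y y) 0.
  have -> : dot x y = 0.
    rewrite /dot (rsum_ext (G := fun j => 0 * x j)); first by rewrite rsumZ; ring.
    by move=> j; rewrite (dot_le0_eq0 y0); ring.
  by have := dot_ge0 x; have := dot_ge0 y; nra.
(* This value of [a] minimizes the quadratic [q]. *)
have := q (dot x y / dot y y).
have -> : dot x x - 2 * (dot x y / dot y y) * dot x y
  + dot x y / dot y y * (dot x y / dot y y) * dot y y
  = (dot x x * dot y y - dot x y * dot x y) / dot y y by field; lra.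
move=> h; have := Rmult_le_pos _ _ h (Rlt_le _ _ y0).
by rewrite /Rdiv Rmult_assoc Rinv_l; lra.
Qed.

Lemma vnorm_ge0 x : 0 <= vnorm x.
Proof. exact: sqrt_pos. Qed.

Lemma vnorm_sqr x : vnorm x ^ 2 = dot x x.
Proof. by rewrite /= Rmult_1_r sqrt_sqrt //; exact: dot_ge0. Qed.

Lemma sqrt_le_of_sqr a b : 0 <= b -> a <= b ^ 2 -> sqrt a <= b.
Proof.
by move=> b0 ab; rewrite -(sqrt_pow2 b) //; apply: sqrt_le_1_alt.
Qed.

Lemma dot_le_vnorm x y : dot x y <= vnorm x * vnorm y.
Proof.
have := dot_cauchy_schwarz x y; rewrite -!vnorm_sqr.
have := vnorm_ge0 x; have := vnorm_ge0 y => y0 x0 h.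
have := Rmult_le_pos _ _ x0 y0 => xy0.
by apply: Rnot_lt_le => lt; nra.
Qed.

Lemma vnormD x y : vnorm (vadd x y) <= vnorm x + vnorm y.
Proof.
have x0 := vnorm_ge0 x; have y0 := vnorm_ge0 y.
apply: sqrt_le_of_sqr; first lra.
rewrite !dotE (dotC y x) -!vnorm_sqr; have := dot_le_vnorm x y; lra.
Qed.

Lemma vnormZ a x : vnorm (vscale a x) = Rabs a * vnorm x.
Proof.
rewrite /vnorm !dotE -Rmult_assoc sqrt_mult_alt; last by nra.
by rewrite -(sqrt_Rsqr_abs a).
Qed.

Lemma vnorm_le_mono x y : (forall j, 0 <= x j <= y j) -> vnorm x <= vnorm y.
Proof.
move=> xy; apply: sqrt_le_1_alt; apply: rsum_le => j.
by have := xy j; nra.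
Qed.

End dot.

(** * Norms of stacked vectors *)

Section snorm.
Variables n p : nat.
Implicit Types x y : stacked n p.

(** Lets the triangle inequality and scaling carry over from [vnorm], applied to the vector of block
    norms. *)
Lemma snorm_vnorm x : snorm x = vnorm (fun i => vnorm (x i)).
Proof.
rewrite /snorm /vnorm /dot; congr sqrt; apply: rsum_ext => i.
by rewrite sqrt_sqrt //; exact: dot_ge0.
Qed.

Lemma snorm_ge0 x : 0 <= snorm x.
Proof. exact: sqrt_pos. Qed.

Lemma snorm_sqr x : snorm x ^ 2 = rsum (fun i => dot (x i) (x i)).
Proof.
rewrite /= Rmult_1_r sqrt_sqrt //; apply: rsum_ge0 => i; exact: dot_ge0.
Qed.

Lemma snormD x y : snorm (fun i => vadd (x i) (y i)) <= snorm x + snorm y.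
Proof.
rewrite !snorm_vnorm.
have := vnormD (fun i => vnorm (x i)) (fun i => vnorm (y i)).
apply: Rle_trans; apply: vnorm_le_mono => i; split; first exact: vnorm_ge0.
exact: vnormD.
Qed.

Lemma snormZ a x : snorm (fun i => vscale a (x i)) = Rabs a * snorm x.
Proof.
rewrite !snorm_vnorm -Rabs_Rabsolu -vnormZ; congr vnorm; apply: functional_extensionality => i.
exact: vnormZ.
Qed.

Lemma snormB x y : snorm (fun i => vsub (x i) (y i)) <= snorm x + snorm y.
Proof.
have := snormD x (fun i => vscale (-1) (y i)).
rewrite snormZ Rabs_Ropp Rabs_R1 Rmult_1_l; congr (_ <= _); congr snorm.
apply: functional_extensionality => i; apply: functional_extensionality => j.
by rewrite /vsub /vadd /vscale; ring.
Qed.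

Lemma snorm_term x i : vnorm (x i) <= snorm x.
Proof.
apply: sqrt_le_1_alt; apply: (@rsum_ge_term _ (fun i => dot (x i) (x i))) => l.
exact: dot_ge0.
Qed.

(** [Z] acts on each of the [p] coordinates separately through [W], so bounds on [W] reach stacked
    vectors by way of columns. *)
Lemma snorm_sqr_columns x : snorm x ^ 2 = rsum (fun j => dot (fun i => x i j) (fun i => x i j)).
Proof. by rewrite snorm_sqr /dot rsum_exchange. Qed.

End snorm.

(** * The spectral norm of a symmetric matrix *)

Section mulf.
Variable n : nat.
Implicit Types (A : 'I_n -> 'I_n -> R) (v w : vec n).

Definition mulf A v : vec n := fun i => rsum (fun l => A i l * v l).

Lemma mulfB A v w : mulf A (vsub v w) = vsub (mulf A v) (mulf A w).
Proof.
apply: functional_extensionality => i; rewrite /vsub /mulf -rsumB.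
by apply: rsum_ext => l; ring.
Qed.

Lemma mulfD A v w : mulf A (vadd v w) = vadd (mulf A v) (mulf A w).
Proof.
apply: functional_extensionality => i; rewrite /vadd /mulf -rsumD.
by apply: rsum_ext => l; ring.
Qed.

Lemma mulfZ A a v : mulf A (vscale a v) = vscale a (mulf A v).
Proof.
apply: functional_extensionality => i; rewrite /vscale /mulf -rsumZ.
by apply: rsum_ext => l; ring.
Qed.

Lemma mulf_comp A B v :
  mulf A (mulf B v) = mulf (fun i l => rsum (fun k => A i k * B k l)) v.
Proof.
apply: functional_extensionality => i; rewrite /mulf.
rewrite (rsum_ext (G := fun k => rsum (fun l => A i k * (B k l * v l)))); last first.
  by move=> k; rewrite rsumZ.
rewrite rsum_exchange; apply: rsum_ext => l.
by rewrite Rmult_comm -rsumZ; apply: rsum_ext => k; ring.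
Qed.

Lemma mulf_adj A v w : (forall i j, A i j = A j i) -> dot (mulf A v) w = dot v (mulf A w).
Proof.
move=> symA; rewrite /dot /mulf.
rewrite (rsum_ext (G := fun i => rsum (fun l => w i * (A i l * v l)))); last first.
  by move=> i; rewrite rsumZ; ring.
rewrite rsum_exchange; apply: rsum_ext => l.
by rewrite -rsumZ; apply: rsum_ext => i; rewrite (symA i); ring.
Qed.

(** Cauchy-Schwarz in each row gives the squared Frobenius norm as a constant; adding [1] makes it
    positive. *)
Lemma mulf_bounded A : exists2 K, 0 < K & forall v, dot (mulf A v) (mulf A v) <= K * dot v v.
Proof.
have K0 : 0 <= rsum (fun i => dot (A i) (A i)) by apply: rsum_ge0 => i; exact: dot_ge0.
exists (1 + rsum (fun i => dot (A i) (A i))); first lra.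
move=> v; apply: (@Rle_trans _ (rsum (fun i => dot v v * dot (A i) (A i)))).
  apply: rsum_le => i; rewrite Rmult_comm Rmult_comm (Rmult_comm (dot v v)).
  exact: dot_cauchy_schwarz.
by rewrite rsumZ; have := dot_ge0 v; nra.
Qed.

(** The determinant decides between the two cases. The transpose appears because [det0P] yields a
    row vector [u] with [u M^T = 0], that is [M u^T = 0]. *)
Lemma kernel_or_left_inverse A :
  (exists v : vec n, (exists i, v i <> 0) /\ forall i, mulf A v i = 0) \/
  (exists C, forall v, v = mulf C (mulf A v)).
Proof.
pose M : 'M[R]_n := (\matrix_(i, j) A i j)%ring.
have [/det0P[u u0 uM]|detM] := boolP (\det M^T == 0)%ring.
  left; exists (fun i => u ord0 i); split.
    have /rV0Pn[i ui] := u0; exists i; exact/eqP.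
  move=> i; move/matrixP/(_ ord0 i): uM; rewrite !mxE => E.
  apply: (etrans _ E); apply: eq_bigr => l _; rewrite !mxE; exact: Rmult_comm.
right; have uM : M \in unitmx by rewrite -unitmx_tr unitmxE GRing.unitfE.
exists (fun i j => invmx M i j) => v; rewrite mulf_comp.
apply: functional_extensionality => i.
rewrite -[LHS]Rmult_1_l -(rsum_delta i 1 v); apply: rsum_ext => l.
have /matrixP/(_ i l) := mulVmx uM; rewrite !mxE => E.
congr (_ * _); transitivity ((i == l)%:R : R)%ring; first by case: (i == l).
by rewrite -E; apply: eq_bigr => k _; rewrite !mxE.
Qed.

Lemma symmetric_norm_le A beta :
  (forall i j, A i j = A j i) -> 0 <= beta ->
  (forall lam, eigenvalue A lam -> Rabs lam <= beta) ->
  forall v, dot (mulf A v) (mulf A v) <= beta ^ 2 * dot v v.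
Proof.
move=> symA beta0 eigA.
have [K K0 AK] := mulf_bounded A.
(* Values of [|A v|^2] on the unit ball; unlike the sphere, the ball is nonempty for every [n]. *)
pose E r := exists2 v : vec n, dot v v <= 1 & r = dot (mulf A v) (mulf A v).
have z0 : dot (fun _ : 'I_n => 0) (fun _ => 0) = 0.
  by rewrite /dot rsum_const; ring.
have Az : mulf A (fun _ : 'I_n => 0) = fun _ => 0.
  apply: functional_extensionality => i.
  rewrite /mulf (rsum_ext (G := fun l => 0 * A i l)) => [|l]; last by ring.
  by rewrite rsumZ; ring.
have E0 : E 0 by exists (fun _ => 0); rewrite ?Az z0; lra.
have bE : bound E.
  by exists K => r [v v1 ->]; have := AK v; nra.
have [s [sub slub]] := completeness E bE (ex_intro _ 0 E0).
have s0 : 0 <= s by exact: sub.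
(* By homogeneity the bound on the unit ball extends to all [v]. *)
have As v : dot (mulf A v) (mulf A v) <= s * dot v v.
  have [v0|v0] := Rle_lt_dec (dot v v) 0.
    by have := AK v; have := dot_ge0 v; nra.
  have sv := sqrt_lt_R0 _ v0; have ss := sqrt_sqrt _ (Rlt_le _ _ v0).
  have e1 : / sqrt (dot v v) * / sqrt (dot v v) = / dot v v.
    by rewrite -Rinv_mult ss.
  have : E (dot (mulf A v) (mulf A v) / dot v v).
    exists (vscale (/ sqrt (dot v v)) v).
      by rewrite !dotE -Rmult_assoc e1 Rinv_l; lra.
    by rewrite mulfZ !dotE -Rmult_assoc e1 /Rdiv Rmult_comm.
  move/sub => h; have := Rmult_le_compat_r _ _ _ (Rlt_le _ _ v0) h.
  by rewrite /Rdiv Rmult_assoc Rinv_l; lra.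
suff sb : s <= beta ^ 2.
  by move=> v; have := As v; have := dot_ge0 v; nra.
have [s_le0|s_gt0] := Rle_lt_dec s 0; first by nra.
(* The matrix of [s - A^2], positive semidefinite by [As]. *)
pose B i l := (if i == l then s else 0) - rsum (fun k => A i k * A k l).
have BE v : mulf B v = vsub (vscale s v) (mulf A (mulf A v)).
  apply: functional_extensionality => i.
  rewrite mulf_comp /vsub /vscale -(rsum_delta i s v) -rsumB.
  by apply: rsum_ext => l; rewrite /B; ring.
have Bdot v : dot (mulf B v) v = s * dot v v - dot (mulf A v) (mulf A v).
  by rewrite BE !dotE (mulf_adj _ _ symA).
have [[v [[i vi] Bv]]|[C CB]] := kernel_or_left_inverse B.
  set r := sqrt s; have r0 : 0 <= r := sqrt_pos s.
  have rr : r * r = s := sqrt_sqrt _ s0.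
  suff : r <= beta by rewrite -rr; nra.
  have AAv l : mulf A (mulf A v) l = s * v l.
    by have := Bv l; rewrite BE /vsub /vscale; lra.
  (* Since [A^2 v = r^2 v], the vector [w = A v + r v] satisfies [A w = r w]. If [w = 0], then [v]
     is an eigenvector for [- r]; otherwise [w] is one for [r]. *)
  have [w0|w0] := Rle_lt_dec (dot (vadd (mulf A v) (vscale r v)) (vadd (mulf A v) (vscale r v))) 0.
    rewrite -(Rabs_pos_eq r) // -Rabs_Ropp; apply: eigA; exists v; split; first by exists i.
    by move=> l; have := dot_le0_eq0 w0 l; rewrite /vadd /vscale /mulf; lra.
  rewrite -(Rabs_pos_eq r) //; apply: eigA.
  exists (vadd (mulf A v) (vscale r v)); split; last first.
    move=> l; rewrite -/(mulf A _ l) mulfD mulfZ /vadd /vscale AAv -rr; ring.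
  apply: Classical_Pred_Type.not_all_not_ex => wz.
  suff : dot (vadd (mulf A v) (vscale r v)) (vadd (mulf A v) (vscale r v)) = 0 by lra.
  rewrite {1}/dot (rsum_ext (G := fun _ => 0)); first by rewrite rsum_const; ring.
  by move=> l; have /Classical_Prop.NNPP -> := wz l; ring.
have [K' K'0 CK] := mulf_bounded C.
(* [v = C (B v)] gives [|v|^2 <= K' |B v|^2], and [0 <= B <= s] gives [|B v|^2 <= s <B v, v>]. *)
have gap v : dot v v <= K' * s * (s * dot v v - dot (mulf A v) (mulf A v)).
  rewrite -Bdot {1 2}(CB v); apply: Rle_trans (CK _) _.
  rewrite Rmult_assoc; apply: Rmult_le_compat_l; first lra.
  (* Positivity of [B] at [v - B v / s]. *)
  have := As (vsub v (vscale (/ s) (mulf B v))).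
  have := Bdot (vsub v (vscale (/ s) (mulf B v))).
  have symB : dot (mulf B (mulf B v)) v = dot (mulf B v) (mulf B v).
    rewrite (mulf_adj _ _ (A := B)) // => a b; rewrite /B eq_sym; congr (_ - _).
    by apply: rsum_ext => k; rewrite (symA a k) (symA k b); ring.
  have := Bdot (mulf B v); have := dot_ge0 (mulf A (mulf B v)).
  rewrite mulfB mulfZ !dotE symB; set b := dot (mulf B v) (mulf B v) => h1 h2 h3 h4.
  set c := dot (mulf B v) v in h3 h4 *; set d := dot (mulf B (mulf B v)) (mulf B v) in h2 h3.
  have : 0 <= c - 2 * / s * b + / s * (/ s * d) by lra.
  have is0 := Rinv_0_lt_compat _ s_gt0.
  have : / s * (/ s * d) <= / s * (/ s * (s * b)).
    apply: Rmult_le_compat_l; first lra.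
    by apply: Rmult_le_compat_l; lra.
  have -> : / s * (/ s * (s * b)) = / s * b by field; lra.
  move=> h5 h6; have : / s * b <= c by lra.
  move/(Rmult_le_compat_l s _ _ (Rlt_le _ _ s_gt0)).
  by have -> : s * (/ s * b) = b by field; lra.
have Ks : 0 < K' * s by nra.
have iKs := Rinv_0_lt_compat _ Ks.
(* The gap yields an upper bound of [E] below [s], against the choice of [s]. The maximum with [0]
   covers the case of a negative factor. *)
have : s <= Rmax 0 (s - / (K' * s)).
  apply: slub => r [v v1 ->]; set a := dot (mulf A v) (mulf A v).
  have : a <= (s - / (K' * s)) * dot v v.
    have := Rmult_le_compat_l _ _ _ (Rlt_le _ _ iKs) (gap v).
    by rewrite -Rmult_assoc Rinv_l; rewrite -/a; lra.
  have := dot_ge0 v; have := Rmax_l 0 (s - / (K' * s)); have := Rmax_r 0 (s - / (K' * s)).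
  by nra.
by rewrite /Rmax; case: Rle_dec; lra.
Qed.

End mulf.

(** * Consensus *)

Definition mean n (v : vec n) : R := / INR n * rsum v.

Definition center n (v : vec n) : vec n := fun i => v i - mean v.

Lemma rsum_mean n (v : vec n) : 'I_n -> rsum v = INR n * mean v.
Proof.
move=> i; have n0 : INR n <> 0 by apply: not_0_INR => n0; move: i; rewrite n0 => -[].
by rewrite /mean; field.
Qed.

Lemma rsum_center n (v : vec n) : rsum (center v) = 0.
Proof.
have [i _|n0] := pickP (@predT 'I_n).
  by rewrite rsumB rsum_const (rsum_mean v i); ring.
by rewrite /rsum big_pred0.
Qed.

Lemma mean_center n (v : vec n) : mean (center v) = 0.
Proof. by rewrite /mean rsum_center Rmult_0_r. Qed.

Lemma INR_ord_gt0 n : 'I_n -> 0 < INR n.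
Proof. by case: n => [[] //|n] _; rewrite S_INR; have := pos_INR n; lra. Qed.

Lemma meanD n (v w : vec n) : mean (fun i => v i + w i) = mean v + mean w.
Proof. by rewrite /mean rsumD; ring. Qed.

Lemma meanZ n a (v : vec n) : mean (fun i => a * v i) = a * mean v.
Proof. by rewrite /mean rsumZ; ring. Qed.

Lemma mean_le n (v w : vec n) : (forall i, v i <= w i) -> mean v <= mean w.
Proof.
move=> vw; apply: Rmult_le_compat_l; last exact: rsum_le.
(* For [n = 0] the factor [/ INR 0] takes the default value [0]. *)
case: n v w vw => [|n] v w vw; first by rewrite /= Rinv_0; lra.
by apply: Rlt_le; apply: Rinv_0_lt_compat; exact: lt_0_INR (Nat.lt_0_succ n).
Qed.

Lemma mean_gt0 n (v : vec n) : 'I_n -> (forall i, 0 < v i) -> 0 < mean v.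
Proof.
move=> i v0; apply: Rmult_lt_0_compat; last exact: rsum_gt0.
exact: Rinv_0_lt_compat (INR_ord_gt0 i).
Qed.

(** Pythagoras: constant vectors are orthogonal to zero-mean vectors. *)
Lemma dot_center n (v : vec n) :
  dot (center v) (center v) = dot v v - INR n * (mean v * mean v).
Proof.
have [i _|n0] := pickP (@predT 'I_n).
  rewrite {1}/dot (rsum_ext (G := fun i => v i * v i + (-2 * mean v * v i + mean v * mean v))).
    by rewrite !rsumD rsumZ rsum_const (rsum_mean v i) -/(dot v v); ring.
  by move=> l; rewrite /center; ring.
case: n v n0 => [|n] v n0; last by have := n0 ord0.
by rewrite /dot /rsum !big_ord0 /=; ring.
Qed.

Lemma mean_sqr_le n (v : vec n) : 'I_n -> mean v * mean v <= / INR n * dot v v.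
Proof.
move=> i; have n0 := INR_ord_gt0 i.
have := dot_ge0 (center v); rewrite dot_center => h.
apply: (Rmult_le_reg_l (INR n)) => //; rewrite -(Rmult_assoc _ (/ _)) Rinv_r; lra.
Qed.

Section network.
Variables (n : nat) (W : 'I_n -> 'I_n -> R).
Hypothesis netW : network_matrix W.

Lemma mean_mulf v : mean (mulf W v) = mean v.
Proof.
have [_ [_ [_ [colW _]]]] := netW.
rewrite /mean /mulf rsum_exchange; congr (_ * _); apply: rsum_ext => l.
rewrite (rsum_ext (G := fun i => v l * W i l)); last by move=> i; ring.
by rewrite rsumZ colW; ring.
Qed.

(** Jensen's inequality in each row, whose entries are weights summing to [1]; summing over the rows
    then uses that each column sums to [1]. *)
Lemma mulf_nonexpansive v : dot (mulf W v) (mulf W v) <= dot v v.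
Proof.
have [_ [W0 [rowW [colW _]]]] := netW.
apply: (@Rle_trans _ (rsum (fun i => rsum (fun l => W i l * (v l * v l))))).
  apply: rsum_le => i; set m := mulf W v i.
  (* The weighted variance of [v] about its weighted mean [m]. *)
  have : 0 <= rsum (fun l => W i l * ((v l - m) * (v l - m))).
    by apply: rsum_ge0 => l; apply: Rmult_le_pos (W0 i l) (Rle_0_sqr _).
  rewrite (rsum_ext (G := fun l => W i l * (v l * v l) + (-2 * m * (W i l * v l) + m * m * W i l))).
    by rewrite !rsumD !rsumZ rowW -/(mulf W v i) -/m; lra.
  by move=> l; ring.
rewrite rsum_exchange; apply: Req_le; apply: rsum_ext => l.
rewrite (rsum_ext (G := fun i => (v l * v l) * W i l)); last by move=> i; ring.
by rewrite rsumZ colW; ring.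
Qed.

(* On centered vectors [W] acts as [W - (1/n) 1 1^T], all of whose eigenvalues
   have modulus at most [beta]: a nonzero eigenvalue of the latter is an
   eigenvalue of [W] with a zero-mean eigenvector, hence differs from 1. *)
Lemma center_mulf_contract beta v : is_SLEM W beta -> 0 <= beta ->
  dot (center (mulf W v)) (center (mulf W v)) <= beta ^ 2 * dot (center v) (center v).
Proof.
move=> [_ slem] beta0.
have [symW [_ [rowW [_ [_ [_ [[_ [[i0 _] _]] [simple _]]]]]]]] := netW.
pose A i l := W i l - / INR n.
have AE u i : mulf A u i = mulf W u i - mean u.
  rewrite /mulf /mean -rsumZ -rsumB; apply: rsum_ext => l; rewrite /A; ring.
have -> : center (mulf W v) = mulf A (center v).
  apply: functional_extensionality => i.
  rewrite AE mean_center Rminus_0_r {1}/center mean_mulf.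
  rewrite -[X in _ - X]Rmult_1_r -(rowW i) -rsumZ -rsumB; apply: rsum_ext => l.
  by rewrite /center; ring.
apply: symmetric_norm_le => // [i j|lam [u [[i ui] Au]]]; first by rewrite /A symW.
have [-> |lam0] := Req_dec lam 0; first by rewrite Rabs_R0.
have mu0 : mean u = 0.
  have : mean (mulf A u) = lam * mean u.
    by rewrite -meanZ; congr mean; apply: functional_extensionality.
  have -> : mulf A u = center (mulf W u).
    by apply: functional_extensionality => l; rewrite AE /center mean_mulf.
  rewrite mean_center => /esym/Rmult_integral[] //.
have Wu l : mulf W u l = lam * u l.
  by have := AE u l; rewrite mu0 => h; rewrite -Au -/(mulf A u l) h; ring.
apply: slem; first by exists u; split; [exists i|].
move=> lam1; apply: ui.
have cu l : u l = u i by apply: simple => a; rewrite -/(mulf W u a) Wu lam1; ring.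
move: mu0; rewrite /mean (rsum_ext cu) rsum_const -Rmult_assoc Rinv_l; first by lra.
by have := INR_ord_gt0 i; lra.
Qed.

(** * Powers of [Z] on stacked vectors *)

Variable p : nat.
Implicit Types y z : stacked n p.

Lemma Zpow_column t y j i : Zpow W t y i j = iter t (mulf W) (fun l => y l j) i.
Proof.
elim: t i => // t IHt i; rewrite /Zpow !iterS -/(Zpow W t y).
by apply: rsum_ext => l; rewrite IHt.
Qed.

(** Unit column sums make mixing preserve averages, so communication rounds do not move the mean
    iterate. *)
Lemma avg_Zpow t y : avg (Zpow W t y) = avg y.
Proof.
apply: functional_extensionality => j; rewrite /avg.
rewrite (rsum_ext (fun i => Zpow_column t y j i)) -/(mean _).
by elim: t => // t IHt; rewrite iterS mean_mulf.
Qed.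

Lemma ZpowB t y z : Zpow W t (fun i => vsub (y i) (z i)) =
  fun i => vsub (Zpow W t y i) (Zpow W t z i).
Proof.
elim: t => // t; rewrite /Zpow !iterS => ->.
apply: functional_extensionality => i; apply: functional_extensionality => j.
by rewrite /vsub /Zmul -rsumB; apply: rsum_ext => l; ring.
Qed.

Lemma snorm_Zpow_le t y : snorm (Zpow W t y) <= snorm y.
Proof.
apply: sqrt_le_of_sqr; first exact: snorm_ge0.
rewrite -snorm_sqr !snorm_sqr_columns; apply: rsum_le => j.
have -> : (fun i => Zpow W t y i j) = iter t (mulf W) (fun l => y l j).
  by apply: functional_extensionality => i; exact: Zpow_column.
elim: t => [|t IHt]; first exact: Rle_refl.
exact: Rle_trans (mulf_nonexpansive _) IHt.
Qed.

(** Each mixing round contracts the centered columns by [beta], and centering does not increase the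
    norm, whence [snorm y] on the right. *)
Lemma snorm_dev_Zpow_le beta t y : is_SLEM W beta -> 0 <= beta ->
  snorm (fun i => vsub (Zpow W t y i) (avg (Zpow W t y))) <= beta ^ t * snorm y.
Proof.
move=> slem beta0; have bt := pow_le _ t beta0.
apply: sqrt_le_of_sqr; first by apply: Rmult_le_pos => //; exact: snorm_ge0.
rewrite -snorm_sqr Rpow_mult_distr !snorm_sqr_columns -rsumZ; apply: rsum_le => j.
have -> : (fun i => vsub (Zpow W t y i) (avg (Zpow W t y)) j) =
    center (iter t (mulf W) (fun l => y l j)).
  apply: functional_extensionality => i; rewrite /vsub Zpow_column /center; congr (_ - _).
  by rewrite /avg (rsum_ext (fun i => Zpow_column t y j i)).
have cle : dot (center (fun l => y l j)) (center (fun l => y l j)) <=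
    dot (fun l => y l j) (fun l => y l j).
  rewrite dot_center; have := pos_INR n; have := Rle_0_sqr (mean (fun l => y l j)).
  by rewrite /Rsqr => a b; have := Rmult_le_pos _ _ b a; lra.
elim: t {bt} => [|t IHt]; first by rewrite /=; lra.
apply: Rle_trans (center_mulf_contract _ slem beta0) _.
have -> : (beta ^ t.+1) ^ 2 = beta ^ 2 * (beta ^ t) ^ 2 by rewrite /=; ring.
by rewrite Rmult_assoc; apply: Rmult_le_compat_l (pow2_ge_0 beta) IHt.
Qed.

End network.

(** * Smooth strongly convex functions *)

(** Common consequence of strong convexity and smoothness from which the contraction estimates
    follow. Being linear in [f], [g], [mu] and [L] jointly, it passes to averages. *)
Definition quadratic_bounds p (mu L : R) (f : vec p -> R) (g : vec p -> vec p) : Prop :=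
  forall x y,
    f x + dot (g x) (vsub y x) + mu / 2 * dot (vsub y x) (vsub y x) <= f y /\
    f y <= f x + dot (g x) (vsub y x) + L / 2 * dot (vsub y x) (vsub y x).

Section gradient.
Variables (p : nat) (f : vec p -> R) (g : vec p -> vec p).

Lemma gradient_line x d s : has_gradient f g ->
  derivable_pt_lim (fun s => f (vadd x (vscale s d))) s (dot (g (vadd x (vscale s d))) d).
Proof.
move=> fg eps eps0.
have shift h : vadd x (vscale (s + h) d) = vadd (vadd x (vscale s d)) (vscale h d).
  by apply: functional_extensionality => j; rewrite /vadd /vscale; ring.
set z := vadd x (vscale s d) in shift *.
(* [has_gradient] only speaks of nonzero increments, so [d = 0] is treated apart. *)
have [d0|d0] := Rle_lt_dec (dot d d) 0.
  exists (mkposreal 1 Rlt_0_1) => h h0 _; rewrite shift.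
  have -> : vadd z (vscale h d) = z.
    by apply: functional_extensionality => j; rewrite /vadd /vscale (dot_le0_eq0 d0); ring.
  have -> : dot (g z) d = 0.
    rewrite /dot (rsum_ext (G := fun j => 0 * g z j)); first by rewrite rsumZ; ring.
    by move=> j; rewrite (dot_le0_eq0 d0); ring.
  by rewrite Rminus_diag /Rdiv Rmult_0_l Rminus_0_r Rabs_R0.
have N0 : 0 < vnorm d := sqrt_lt_R0 _ d0.
(* The factor [2] turns the nonstrict bound of [has_gradient] into the strict one of the
   derivative. *)
have e0 : 0 < eps / (2 * vnorm d) by apply: Rdiv_lt_0_compat; lra.
have [delta [delta0 H]] := fg z _ e0.
have dN0 : 0 < delta / vnorm d by apply: Rdiv_lt_0_compat.
exists (mkposreal _ dN0) => h h0 /= hd; rewrite shift.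
have ah : 0 < Rabs h by apply: Rabs_pos_lt.
have /H : 0 < vnorm (vscale h d) < delta.
  rewrite vnormZ; split; first exact: Rmult_lt_0_compat.
  have := Rmult_lt_compat_r _ _ _ N0 hd.
  by rewrite /Rdiv Rmult_assoc Rinv_l; lra.
rewrite dotZr vnormZ.
have -> : eps / (2 * vnorm d) * (Rabs h * vnorm d) = eps / 2 * Rabs h by field; lra.
move=> le.
have -> : (f (vadd z (vscale h d)) - f z) / h - dot (g z) d =
  (f (vadd z (vscale h d)) - f z - h * dot (g z) d) / h by field.
rewrite {1}/Rdiv Rabs_mult Rabs_inv; apply: (Rmult_lt_reg_r (Rabs h)) => //.
by rewrite Rmult_assoc Rinv_l; [nra | lra].
Qed.

Lemma vaddBK (x y : vec p) : vadd x (vscale 1 (vsub y x)) = y.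
Proof. by apply: functional_extensionality => j; rewrite /vadd /vscale /vsub; ring. Qed.

Lemma vadd0 (x d : vec p) : vadd x (vscale 0 d) = x.
Proof. by apply: functional_extensionality => j; rewrite /vadd /vscale; ring. Qed.

(** Strong convexity bounds the difference quotient of [f] from [x] towards [y], and the quotient
    tends to the directional derivative. The limit is taken by contradiction, with [e] the supposed
    excess. *)
Lemma strongly_convex_lower mu x y : has_gradient f g -> strongly_convex mu f ->
  f x + dot (g x) (vsub y x) + mu / 2 * dot (vsub y x) (vsub y x) <= f y.
Proof.
move=> fg [mu0 sc]; apply: Rnot_lt_le => lt.
set d := vsub y x in lt *; set q := dot d d in lt *.
have q0 : 0 <= q := dot_ge0 d.
set e := f x + dot (g x) d + mu / 2 * q - f y.
have e0 : 0 < e / 2 by rewrite /e; lra.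
have [[delta delta0] H] := gradient_line x d 0 fg e0.
have m0 : 0 < 1 + mu * q by nra.
(* Small enough for convexity ([th <= 1]), for the derivative ([th < delta]), and for the leftover
   term [mu / 2 * th * q] to stay below [e / 2]. *)
pose th := Rmin (Rmin 1 (delta / 2)) (e / (1 + mu * q)).
have th0 : 0 < th.
  by apply: Rmin_pos; [apply: Rmin_pos; lra | apply: Rdiv_lt_0_compat; lra].
have th1 : th <= 1 by apply: Rle_trans (Rmin_l _ _) (Rmin_l _ _).
have thd : th < delta.
  by have : th <= delta / 2; [apply: Rle_trans (Rmin_l _ _) (Rmin_r _ _) | lra].
have thq : th * (1 + mu * q) <= e.
  have h : th <= e / (1 + mu * q) := Rmin_r _ _.
  have := Rmult_le_compat_r _ _ _ (Rlt_le _ _ m0) h.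
  by rewrite /Rdiv Rmult_assoc Rinv_l; lra.
have := H th; rewrite Rplus_0_l vadd0 /= (Rabs_pos_eq th); last lra.
move=> /(_ (Rgt_not_eq _ _ th0) thd) /Rabs_def2[_].
have := sc y x th (conj (Rlt_le _ _ th0) th1).
have -> : vadd (vscale th y) (vscale (1 - th) x) = vadd x (vscale th d).
  by apply: functional_extensionality => j; rewrite /vadd /vscale /d /vsub; ring.
rewrite vnorm_sqr -/d -/q; set F := f _ => h1 h2.
have h3 : F - f x <= th * (f y - f x - mu / 2 * (1 - th) * q) by lra.
have h4 : (F - f x) / th <= f y - f x - mu / 2 * (1 - th) * q.
  apply: (Rmult_le_reg_l th) => //.
  by have -> : th * ((F - f x) / th) = F - f x by field; lra.
by rewrite /e in thq h2; nra.
Qed.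

(** Mean value theorem for [F], the restriction of [f] to the segment minus its linear and quadratic
    terms: Cauchy-Schwarz and the Lipschitz bound give [F' <= 0]. *)
Lemma lipschitz_upper L x y : has_gradient f g -> lipschitz L g ->
  f y <= f x + dot (g x) (vsub y x) + L / 2 * dot (vsub y x) (vsub y x).
Proof.
move=> fg lip; set d := vsub y x.
pose F s := f (vadd x (vscale s d)) - (dot (g x) d * s + L / 2 * dot d d * (s * s)).
pose F' s := dot (g (vadd x (vscale s d))) d - (dot (g x) d * 1 + L / 2 * dot d d * (1 * s + s * 1)).
have dF c : 0 <= c <= 1 -> derivable_pt_lim F c (F' c).
  move=> _; apply: (derivable_pt_lim_minus _ _ _ _ _ (gradient_line x d c fg)).
  apply: (derivable_pt_lim_plus (fun s => dot (g x) d * s) (fun s => L / 2 * dot d d * (s * s))).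
    exact: (derivable_pt_lim_scal id _ _ _ (derivable_pt_lim_id c)).
  apply: (derivable_pt_lim_scal (fun s => s * s)).
  exact: (derivable_pt_lim_mult id id _ _ _ (derivable_pt_lim_id c) (derivable_pt_lim_id c)).
have [c [E [c0 c1]]] := MVT_cor2 F F' 0 1 Rlt_0_1 dF.
move: E; rewrite {1 2}/F vadd0 vaddBK.
suff : F' c <= 0 by lra.
have := dot_le_vnorm (vsub (g (vadd x (vscale c d))) (g x)) d.
have := lip (vadd x (vscale c d)) x.
have -> : vsub (vadd x (vscale c d)) x = vscale c d.
  by apply: functional_extensionality => j; rewrite /vadd /vscale /vsub; ring.
rewrite vnormZ Rabs_pos_eq; last lra.
rewrite dotBl /F' -!vnorm_sqr; have := vnorm_ge0 d; nra.
Qed.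

(** * Consequences of the quadratic bounds *)

Section bounds.
Variables mu L : R.
Hypothesis fb : quadratic_bounds mu L f g.

Lemma quadratic_bounds_le : 'I_p -> mu <= L.
Proof.
move=> j; have [] := fb (fun _ => 0) (fun _ => 1).
set d := vsub _ _ => h1 h2.
have := @dot_gt0 _ d j; rewrite {1}/d /vsub => /(_ ltac:(lra)); nra.
Qed.

(** A gradient step of length [1 / L] would lower [f] by at least [|g x|^2 / (2 L)]. *)
Lemma minimizer_gradient0 x : 0 < L -> is_minimizer f x -> forall j, g x j = 0.
Proof.
move=> L0 fx; apply: dot_le0_eq0.
have iL := Rinv_0_lt_compat _ L0.
have [_] := fb x (vsub x (vscale (/ L) (g x))).
have -> : vsub (vsub x (vscale (/ L) (g x))) x = vscale (- / L) (g x).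
  by apply: functional_extensionality => j; rewrite /vscale /vsub; ring.
rewrite !dotE; have := fx (vsub x (vscale (/ L) (g x))).
have -> : L / 2 * (- / L * (- / L * dot (g x) (g x))) = / L / 2 * dot (g x) (g x) by field; lra.
by nra.
Qed.

(* Compare both bounds at [z = x - w / M], with [w] the gradient difference of
   [f - mu/2 |.|^2]. *)
Lemma bregman_lower M x y : 0 < M -> L - mu <= M ->
  let w := vsub (vsub (g x) (g y)) (vscale mu (vsub x y)) in
  / M / 2 * dot w w <=
  f x - f y - dot (g y) (vsub x y) - mu / 2 * dot (vsub x y) (vsub x y).
Proof.
move=> M0 LM w; set d := vsub x y.
have im0 := Rinv_0_lt_compat _ M0; set im := / M in im0 *.
have Mim : M * im = 1 by apply: Rinv_r; lra.
pose z := vsub x (vscale im w).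
have [low _] := fb y z; have [_ upp] := fb x z; move: low upp.
have -> : vsub z y = vsub d (vscale im w).
  by apply: functional_extensionality => j; rewrite /z /d /vscale /vsub; ring.
have -> : vsub z x = vscale (- im) w.
  by apply: functional_extensionality => j; rewrite /z /vscale /vsub; ring.
have E u : dot w u = dot (g x) u - dot (g y) u - mu * dot d u by rewrite /w /d !dotE.
move: (E w); clearbody w d; rewrite !dotE (dotC w d).
have := dot_ge0 w; move: (dot w w) (dot d w) (dot (g x) w) (dot (g y) w) => W a b c W0 {}E l u.
have : 0 <= (1 - (L - mu) * im) * (im * W).
  by apply: Rmult_le_pos; nra.
have : im * W = im * b - im * c - mu * (im * a) by rewrite E; ring.
by nra.
Qed.

(** Adding [bregman_lower] for [(x, y)] and [(y, x)] gives [|w|^2 <= M <w, d>], which for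
    [M = L - mu] expands to the claim. As [L - mu] may vanish, this value is reached as a limit of
    positive [M]. *)
Lemma cocoercive x y : mu <= L ->
  mu * L * dot (vsub x y) (vsub x y) + dot (vsub (g x) (g y)) (vsub (g x) (g y))
  <= (mu + L) * dot (vsub (g x) (g y)) (vsub x y).
Proof.
move=> muL; set d := vsub x y; set D := vsub (g x) (g y).
set w := vsub D (vscale mu d).
have key M : 0 < M -> L - mu <= M -> dot w w <= M * dot w d.
  move=> M0 LM; have := bregman_lower x y M0 LM; have := bregman_lower y x M0 LM.
  rewrite /= -/d -/D -/w.
  have -> : vsub (vsub (g y) (g x)) (vscale mu (vsub y x)) = vscale (-1) w.
    by apply: functional_extensionality => j; rewrite /w /D /d /vscale /vsub; ring.
  have -> : vsub y x = vscale (-1) d.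
    by apply: functional_extensionality => j; rewrite /d /vscale /vsub; ring.
  have Ew : dot w d = dot D d - mu * dot d d by rewrite /w !dotE.
  have ED : dot D d = dot (g x) d - dot (g y) d by rewrite /D !dotE.
  clearbody w D d; rewrite !dotE => h1 h2.
  have : / M * dot w w <= dot w d by rewrite Ew ED; lra.
  move/(Rmult_le_compat_l M _ _ (Rlt_le _ _ M0)).
  by rewrite -Rmult_assoc Rinv_r; lra.
have : dot w w <= (L - mu) * dot w d.
  apply: Rnot_lt_le => lt.
  have wd0 : 0 <= dot w d.
    by have := key (L - mu + 1) ltac:(lra) ltac:(lra); have := dot_ge0 w; nra.
  (* With [M = L - mu + e], the bound [key] would give [|w|^2 <= |w|^2 - e]. *)
  pose e := (dot w w - (L - mu) * dot w d) / (dot w d + 1).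
  have e0 : 0 < e by apply: Rdiv_lt_0_compat; lra.
  have eE : e * (dot w d + 1) = dot w w - (L - mu) * dot w d by rewrite /e; field; lra.
  by have := key (L - mu + e) ltac:(lra) ltac:(lra); lra.
by rewrite /w; clearbody D d; rewrite !dotE (dotC d D); lra.
Qed.

Lemma gradient_step_contract alpha x y : 0 < mu -> mu <= L -> 0 <= alpha -> alpha <= 2 / (mu + L) ->
  dot (vsub (vsub x (vscale alpha (g x))) (vsub y (vscale alpha (g y))))
      (vsub (vsub x (vscale alpha (g x))) (vsub y (vscale alpha (g y))))
  <= (1 - alpha * (2 * mu * L / (mu + L))) * dot (vsub x y) (vsub x y).
Proof.
move=> mu0 muL a0 a2.
have -> : vsub (vsub x (vscale alpha (g x))) (vsub y (vscale alpha (g y))) =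
    vsub (vsub x y) (vscale alpha (vsub (g x) (g y))).
  by apply: functional_extensionality => j; rewrite /vscale /vsub; ring.
have := cocoercive x y muL; move: (vsub x y) (vsub (g x) (g y)) => d D co.
rewrite [in X in X <= _]dotBl !dotBr !dotZl !dotZr (dotC d D).
have s0 : 0 < mu + L by lra.
have is0 := Rinv_0_lt_compat _ s0.
have {co} : / (mu + L) * (mu * L * dot d d + dot D D) <= dot D d.
  have := Rmult_le_compat_l _ _ _ (Rlt_le _ _ is0) co.
  by rewrite -Rmult_assoc Rinv_l; lra.
rewrite /Rdiv in a2 *; set i := / (mu + L) in a2 *.
move: (dot_ge0 D); move: (dot D D) (dot D d) (dot d d) => DD Dd dd DD0 co.
have := Rmult_le_compat_l _ _ _ a0 co.
have : 0 <= (2 * i - alpha) * (alpha * DD) by apply: Rmult_le_pos; nra.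
lra.
Qed.

End bounds.
End gradient.

(** * Averages of functions and gradients *)

Lemma dot_avg n p (g : stacked n p) v : dot (avg g) v = mean (fun i => dot (g i) v).
Proof.
rewrite /mean /dot rsum_exchange -rsumZ; apply: rsum_ext => j; rewrite /avg Rmult_assoc.
by congr (_ * _); rewrite Rmult_comm -rsumZ; apply: rsum_ext => i; ring.
Qed.

Lemma vnorm_avg_sqr_le n p (g : stacked n p) : 'I_n ->
  dot (avg g) (avg g) <= / INR n * snorm g ^ 2.
Proof.
move=> i; rewrite snorm_sqr_columns -rsumZ; apply: rsum_le => j.
exact: (mean_sqr_le (fun l => g l j) i).
Qed.

(** By linearity the constants of the mean function are the means of the constants rather than their
    extremes. *)
Lemma quadratic_bounds_mean n p (mu L : vec n) (f : 'I_n -> vec p -> R) g :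
  (forall i, quadratic_bounds (mu i) (L i) (f i) (g i)) ->
  quadratic_bounds (mean mu) (mean L) (fun z => mean (fun i => f i z)) (fun z => avg (fun i => g i z)).
Proof.
move=> fb x y; rewrite dot_avg; set q := dot (vsub y x) _.
have E (c : vec n) : mean (fun i => f i x) + mean (fun i => dot (g i x) (vsub y x)) + mean c / 2 * q =
    mean (fun i => f i x + dot (g i x) (vsub y x) + q / 2 * c i).
  by rewrite !meanD meanZ; field.
rewrite !E; split; apply: mean_le => i; have [] := fb i x y; rewrite -/q; lra.
Qed.

(** * NEAR-DGD+ *)

Lemma foldr_Rmax_ge a (s : seq R) b : b \in a :: s -> b <= foldr Rmax a s.
Proof.
elim: s => [|c s IHs] /=; first by rewrite inE => /eqP ->; lra.
rewrite !inE orbCA => /orP[/eqP -> |bs]; first exact: Rmax_l.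
by apply: Rle_trans (IHs _) (Rmax_r _ _); rewrite inE.
Qed.

Lemma maxR_ge n (F : 'I_n -> R) i : F i <= maxR F.
Proof.
have : F i \in map F (enum 'I_n) by apply: map_f; rewrite mem_enum.
by rewrite /maxR; case: (map _ _) => // a s; exact: foldr_Rmax_ge.
Qed.

Lemma foldr_Rmin_le a (s : seq R) b : b \in a :: s -> foldr Rmin a s <= b.
Proof.
elim: s => [|c s IHs] /=; first by rewrite inE => /eqP ->; lra.
rewrite !inE orbCA => /orP[/eqP -> |bs]; first exact: Rmin_l.
by apply: Rle_trans (Rmin_r _ _) (IHs _); rewrite inE.
Qed.

Lemma minR_le n (F : 'I_n -> R) i : minR F <= F i.
Proof.
have : F i \in map F (enum 'I_n) by apply: map_f; rewrite mem_enum.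
by rewrite /minR; case: (map _ _) => // a s; exact: foldr_Rmin_le.
Qed.

Lemma minR_gt0 n (F : 'I_n -> R) : 'I_n -> (forall i, 0 < F i) -> 0 < minR F.
Proof.
move=> i F0; rewrite /minR.
have : F i \in map F (enum 'I_n) by apply: map_f; rewrite mem_enum.
have : forall b, b \in map F (enum 'I_n) -> 0 < b by move=> b /mapP[j _ ->].
case: (map _ _) => // a s as0 _.
elim: s as0 => [|c s IHs] as0 /=; first by apply: as0; rewrite inE.
apply: Rmin_pos; first by apply: as0; rewrite !inE eqxx orbT.
by apply: IHs => b; rewrite inE => bs; apply: as0; rewrite !inE orbCA bs orbT.
Qed.

(** * Convergence of scalar sequences *)

Lemma Un_cv_contraction (a b : nat -> R) q : 0 <= q < 1 -> (forall k, 0 <= a k) ->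
  (forall k, a k.+1 <= q * a k + b k) -> Un_cv b 0 -> Un_cv a 0.
Proof.
move=> q01 a0 step cvb eps eps0.
(* For a perturbation of this size, [eps / 2] is a fixed point of the perturbed contraction. *)
have e0 : 0 < (1 - q) * (eps / 2) by apply: Rmult_lt_0_compat; lra.
have [N HN] := cvb _ e0.
have bnd m : a (N + m)%coq_nat <= q ^ m * a N + eps / 2.
  elim: m => [|m IHm]; first by rewrite Nat.add_0_r /=; lra.
  rewrite Nat.add_succ_r; apply: Rle_trans (step _) _.
  have := HN (N + m)%coq_nat (Nat.le_add_r _ _).
  rewrite /Rdist Rminus_0_r => /Rabs_def2[h _].
  by have := Rmult_le_compat_l q _ _ (proj1 q01) IHm; rewrite /=; lra.
have aN := a0 N.
(* The [1] keeps the divisor positive when [a N = 0]. *)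
have e1 : 0 < eps / 2 / (a N + 1) by apply: Rdiv_lt_0_compat; lra.
have q1 : Rabs q < 1 by rewrite Rabs_pos_eq; lra.
have [M HM] := pow_lt_1_zero q q1 _ e1.
exists (N + M)%coq_nat => k kNM; rewrite /Rdist Rminus_0_r Rabs_pos_eq //.
have kE : k = Nat.add N (Nat.sub k N) by lia.
rewrite kE; apply: Rle_lt_trans (bnd _) _.
have := HM (Nat.sub k N) ltac:(lia).
have qk := pow_le q (Nat.sub k N) (proj1 q01); rewrite Rabs_pos_eq //.
move/(Rmult_lt_compat_r (a N + 1) _ _ ltac:(lra)).
by rewrite /Rdiv Rmult_assoc Rinv_l; lra.
Qed.

Lemma Un_cv_pow_comp q (t : nat -> nat) C : 0 <= q < 1 ->
  (forall M : nat, exists K : nat, forall k, (K <= k)%nat -> (M <= t k)%nat) ->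
  Un_cv (fun k => C * q ^ t k) 0.
Proof.
move=> q01 tinf eps eps0; have C0 := Rabs_pos C.
have q1 : Rabs q < 1 by rewrite Rabs_pos_eq; lra.
have e0 : 0 < eps / (Rabs C + 1) by apply: Rdiv_lt_0_compat; lra.
have [M HM] := pow_lt_1_zero q q1 _ e0; have [K HK] := tinf M.
exists K => k kK; rewrite /Rdist Rminus_0_r Rabs_mult.
have := HM (t k) (elimT leP (HK k (introT leP kK))).
have := Rabs_pos (q ^ t k) => r0.
move/(Rmult_lt_compat_r (Rabs C + 1) _ _ ltac:(lra)).
by rewrite /Rdiv Rmult_assoc Rinv_l; lra.
Qed.

Lemma Un_cv_sqr0 (a : nat -> R) : Un_cv (fun k => a k ^ 2) 0 -> Un_cv a 0.
Proof.
move=> cva eps eps0; have e0 : 0 < eps ^ 2 by apply: pow_lt.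
have [N HN] := cva _ e0; exists N => k kN; have := HN k kN.
rewrite /Rdist !Rminus_0_r -RPow_abs; have := Rabs_pos (a k) => h1 h2.
by apply: Rnot_le_lt => h3; rewrite /= in h2; nra.
Qed.

(** Young's inequality, from [|e x - y|^2 >= 0] divided by [e]. *)
Lemma dotD_young p (x y : vec p) e : 0 < e ->
  dot (vadd x y) (vadd x y) <= (1 + e) * dot x x + (1 + / e) * dot y y.
Proof.
move=> e0; have ie := Rinv_0_lt_compat _ e0.
have h : 0 <= e * e * dot x x - 2 * e * dot x y + dot y y.
  by have := dot_ge0 (vsub (vscale e x) y); rewrite !dotE (dotC y x); lra.
have := Rmult_le_pos _ _ (Rlt_le _ _ ie) h.
have -> : / e * (e * e * dot x x - 2 * e * dot x y + dot y y) =
  e * dot x x - 2 * dot x y + / e * dot y y by field; lra.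
by rewrite !dotE (dotC y x); lra.
Qed.

(** * Estimates for the iterates *)

Section near_dgd.
Variables (n p : nat) (W : 'I_n -> 'I_n -> R) (beta : R).
Variables (f : 'I_n -> vec p -> R) (g : 'I_n -> vec p -> vec p) (mu Lc : 'I_n -> R).
Hypothesis netW : network_matrix W.
Hypothesis slemW : is_SLEM W beta.
Hypothesis beta0 : 0 <= beta.
Hypothesis mu0 : forall i, 0 < mu i.
Hypothesis muL : forall i, mu i <= Lc i.
Hypothesis lipg : forall i, lipschitz (Lc i) (g i).
Hypothesis fb : forall i, quadratic_bounds (mu i) (Lc i) (f i) (g i).

Let L := maxR Lc.
Let mubar := mean mu.
Let Lbar := mean Lc.
Let c2 := 2 * mubar * Lbar / (mubar + Lbar).

Lemma Lc_le i : 0 < Lc i <= L.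
Proof. by split; [have := mu0 i; have := muL i; lra | exact: maxR_ge]. Qed.

(** Jensen's inequality moves the square inside the average, and the Lipschitz bounds apply node by
    node; the factor [1 / n] is bounded by [1]. *)
Lemma dev_gradient_le (x : stacked n p) : 'I_n ->
  let e := avg (fun i => vsub (g i (avg x)) (g i (x i))) in
  dot e e <= L ^ 2 * snorm (fun i => vsub (x i) (avg x)) ^ 2.
Proof.
move=> i0 e; apply: Rle_trans (vnorm_avg_sqr_le _ i0) _.
have n1 : 1 <= INR n.
  by rewrite -INR_1; apply: le_INR; case: n i0 => [[] // | m _]; exact/leP.
have in0 : 0 < / INR n <= 1.
  by split; [apply: Rinv_0_lt_compat; lra | rewrite -Rinv_1; apply: Rinv_le_contravar; lra].
set d := fun i => vsub (g i (avg x)) (g i (x i)).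
suff : snorm d ^ 2 <= L ^ 2 * snorm (fun i => vsub (x i) (avg x)) ^ 2.
  by have := pow2_ge_0 (snorm d); nra.
rewrite !snorm_sqr -rsumZ; apply: rsum_le => i.
have h := lipg i (avg x) (x i); have [l1 l2] := Lc_le i.
have -> : dot (vsub (x i) (avg x)) (vsub (x i) (avg x)) = dot (vsub (avg x) (x i)) (vsub (avg x) (x i)).
  by apply: rsum_ext => j; rewrite /vsub; ring.
rewrite -!vnorm_sqr -Rpow_mult_distr; apply: pow_incr; split; first exact: vnorm_ge0.
apply: Rle_trans h _; apply: Rmult_le_compat_r l2; exact: vnorm_ge0.
Qed.

Section step.
Variable alpha : R.
Hypotheses (a0 : 0 < alpha) (aL : alpha <= / L) (a4 : alpha <= 2 / (mubar + Lbar)).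

(** The new average is the exact gradient step from [avg x] plus [alpha * e], with [e] the gradient
    error. Young's weight [alpha * delta] produces both constants: the first is
    [(1 + alpha * delta) * (1 - alpha * c2)], expanded. *)
Lemma avg_step_le xstar (x : stacked n p) delta : 'I_n ->
  is_minimizer (fun z => rsum (fun i => f i z)) xstar -> 0 < delta ->
  let xn := avg (fun i => vsub (x i) (vscale alpha (g i (x i)))) in
  dot (vsub xn xstar) (vsub xn xstar)
  <= (1 - alpha * c2 + alpha * delta - alpha ^ 2 * delta * c2)
       * dot (vsub (avg x) xstar) (vsub (avg x) xstar)
     + alpha * (alpha + / delta) * L ^ 2 * snorm (fun i => vsub (x i) (avg x)) ^ 2.
Proof.
move=> i0 minx delta0 xn.
pose gbar z := avg (fun i => g i z).
have qb : quadratic_bounds mubar Lbar (fun z => mean (fun i => f i z)) gbar by exact: quadratic_bounds_mean.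
have mub0 : 0 < mubar by exact: mean_gt0.
have muLb : mubar <= Lbar by exact: mean_le.
have gx0 : forall j, gbar xstar j = 0.
  apply: (minimizer_gradient0 qb) => [|z]; first lra.
  apply: Rmult_le_compat_l (minx z).
  by apply: Rlt_le; apply: Rinv_0_lt_compat (INR_ord_gt0 i0).
have := gradient_step_contract qb (avg x) xstar mub0 muLb (Rlt_le _ _ a0) a4.
set e := avg (fun i => vsub (g i (avg x)) (g i (x i))).
set s := vsub (vsub _ _) _ => cs.
have -> : vsub xn xstar = vadd s (vscale alpha e).
  apply: functional_extensionality => j.
  rewrite /s /e /xn /vadd /vsub /vscale gx0 /gbar /avg !rsumB rsumZ; ring.
have ad0 : 0 < alpha * delta by exact: Rmult_lt_0_compat.
apply: Rle_trans (dotD_young s (vscale alpha e) ad0) _.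
rewrite dotZl dotZr.
have -> : (1 + / (alpha * delta)) * (alpha * (alpha * dot e e)) =
    alpha * (alpha + / delta) * dot e e by field; lra.
have id0 := Rinv_0_lt_compat _ delta0.
apply: Rplus_le_compat.
  have := Rmult_le_compat_l (1 + alpha * delta) _ _ ltac:(lra) cs.
  rewrite -/c2; lra.
rewrite (Rmult_assoc _ (L ^ 2)); apply: Rmult_le_compat_l; last exact: (dev_gradient_le x i0).
by apply: Rmult_le_pos; lra.
Qed.

Let nu := 2 * alpha * minR (fun i => mu i * Lc i / (mu i + Lc i)).

(** The upper bound, from [2 mu_i L_i / (mu_i + L_i) <= L_i] and [alpha L_i <= 1], keeps
    [1 - nu / 2] positive. *)
Lemma nu_bounds : 'I_n -> 0 < nu <= 1.
Proof.
move=> i; have [l0 lL] := Lc_le i; have m0 := mu0 i; have ml := muL i; split.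
  apply: Rmult_lt_0_compat; first lra.
  apply: minR_gt0 => // j; have [l1 _] := Lc_le j; have m1 := mu0 j.
  by apply: Rdiv_lt_0_compat; [exact: Rmult_lt_0_compat | lra].
have h : minR (fun i => mu i * Lc i / (mu i + Lc i)) <= mu i * Lc i / (mu i + Lc i) := minR_le _ i.
have L0 : 0 < L by lra.
have aL1 : alpha * Lc i <= 1.
  have := Rmult_le_compat_r _ _ _ (Rlt_le _ _ L0) aL; rewrite Rinv_l; nra.
have h2 : 2 * (mu i * Lc i / (mu i + Lc i)) <= Lc i.
  apply: (Rmult_le_reg_r (mu i + Lc i)); first lra.
  have -> : 2 * (mu i * Lc i / (mu i + Lc i)) * (mu i + Lc i) = 2 * (mu i * Lc i) by field; lra.
  by nra.
rewrite /nu; nra.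
Qed.

(** Each block contracts in squared norm by [1 - nu], and [1 - nu <= (1 - nu / 2)^2]. *)
Lemma local_step_le (ustar x : stacked n p) : 'I_n ->
  (forall i, is_minimizer (f i) (ustar i)) ->
  snorm (fun i => vsub (vsub (x i) (vscale alpha (g i (x i)))) (ustar i))
  <= (1 - nu / 2) * snorm (fun i => vsub (x i) (ustar i)).
Proof.
move=> i0 minu; have [nu0 nu1] := nu_bounds i0.
have s0 := snorm_ge0 (fun i => vsub (x i) (ustar i)).
apply: sqrt_le_of_sqr; first by apply: Rmult_le_pos; lra.
apply: (@Rle_trans _ ((1 - nu) * snorm (fun i => vsub (x i) (ustar i)) ^ 2)); last first.
  rewrite Rpow_mult_distr; apply: Rmult_le_compat_r; [exact: pow2_ge_0 | nra].
rewrite snorm_sqr -rsumZ; apply: rsum_le => i.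
have [l0 lL] := Lc_le i; have m0 := mu0 i; have ml := muL i.
have u0 := minimizer_gradient0 (fb i) l0 (minu i).
(* Through [1 / L <= 1 / L_i <= 2 / (mu_i + L_i)]. *)
have aL' : alpha <= 2 / (mu i + Lc i).
  apply: Rle_trans aL _; apply: (@Rle_trans _ (/ Lc i)).
    by apply: Rinv_le_contravar.
  apply: (Rmult_le_reg_r (Lc i * (mu i + Lc i))); first by nra.
  have -> : / Lc i * (Lc i * (mu i + Lc i)) = mu i + Lc i by field; lra.
  have -> : 2 / (mu i + Lc i) * (Lc i * (mu i + Lc i)) = 2 * Lc i by field; lra.
  lra.
have := gradient_step_contract (fb i) (x i) (ustar i) m0 ml (Rlt_le _ _ a0) aL'.
have -> : vsub (ustar i) (vscale alpha (g i (ustar i))) = ustar i.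
  by apply: functional_extensionality => j; rewrite /vsub /vscale u0; ring.
move=> h; apply: Rle_trans h _; apply: Rmult_le_compat_r; first exact: dot_ge0.
have h : minR (fun i => mu i * Lc i / (mu i + Lc i)) <= mu i * Lc i / (mu i + Lc i) := minR_le _ i.
have -> : alpha * (2 * mu i * Lc i / (mu i + Lc i)) = 2 * alpha * (mu i * Lc i / (mu i + Lc i)).
  by field; lra.
rewrite /nu; nra.
Qed.

Variables (t : nat -> nat) (x y : nat -> stacked n p) (ustar : stacked n p).
Hypothesis minu : forall i, is_minimizer (f i) (ustar i).
Hypothesis xE : forall k, x k = Zpow W (t k) (y k).
Hypothesis yE : forall k i, y k.+1 i = vsub (x k i) (vscale alpha (g i (x k i))).

(** The distance [a] of [y k] to [ustar] becomes at most [(1 - nu / 2) * (a + 2 |ustar|)], and this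
    map preserves the bound [r0 + 4 / nu * |ustar|]. One more [|ustar|] passes from the distance to
    the norm. *)
Lemma iterates_bounded k : 'I_n ->
  snorm (y k) <= snorm (fun i => vsub (y 0%nat i) (ustar i)) + (nu + 4) / nu * snorm ustar.
Proof.
move=> i0; have [nu0 nu1] := nu_bounds i0.
have u0 := snorm_ge0 ustar; set r0 := snorm (fun i => vsub (y 0%nat i) _).
have r00 : 0 <= r0 by exact: snorm_ge0.
have nuE : (nu + 4) / nu = 1 + 4 / nu by field; lra.
have n4 : nu * (4 / nu) = 4 by field; lra.
have n40 : 0 < 4 / nu by apply: Rdiv_lt_0_compat; lra.
suff : snorm (fun i => vsub (y k i) (ustar i)) <= r0 + 4 / nu * snorm ustar.
  have := snormD (fun i => vsub (y k i) (ustar i)) ustar.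
  have -> : (fun i => vadd (vsub (y k i) (ustar i)) (ustar i)) = y k.
    apply: functional_extensionality => i; apply: functional_extensionality => j.
    by rewrite /vadd /vsub; ring.
  by rewrite nuE; lra.
elim: k => [|k IHk]; first by rewrite -/r0; nra.
have -> : (fun i => vsub (y k.+1 i) (ustar i)) =
    fun i => vsub (vsub (x k i) (vscale alpha (g i (x k i)))) (ustar i).
  by apply: functional_extensionality => i; rewrite yE.
apply: Rle_trans (local_step_le (x k) i0 minu) _.
(* Split [x k - ustar] into [Z^t (y k - ustar)] and [Z^t ustar - ustar], with [Z] nonexpansive. *)
have : snorm (fun i => vsub (x k i) (ustar i)) <=
    snorm (fun i => vsub (y k i) (ustar i)) + 2 * snorm ustar.
  have := snormD (Zpow W (t k) (fun i => vsub (y k i) (ustar i)))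
                 (fun i => vsub (Zpow W (t k) ustar i) (ustar i)).
  have -> : (fun i => vadd (Zpow W (t k) (fun i => vsub (y k i) (ustar i)) i)
       (vsub (Zpow W (t k) ustar i) (ustar i))) = fun i => vsub (x k i) (ustar i).
    rewrite ZpowB -xE.
    apply: functional_extensionality => i; apply: functional_extensionality => j.
    by rewrite /vadd /vsub; ring.
  have := snormB (Zpow W (t k) ustar) ustar.
  have := snorm_Zpow_le netW (t k) ustar.
  have := snorm_Zpow_le netW (t k) (fun i => vsub (y k i) (ustar i)).
  lra.
have := snorm_ge0 (fun i => vsub (x k i) (ustar i)).
move: IHk; set b := snorm (fun i => vsub (y k i) _).
set a := snorm (fun i => vsub (x k i) _) => h1 a1 h2.
have : (1 - nu / 2) * a <= (1 - nu / 2) * (r0 + 4 / nu * snorm ustar + 2 * snorm ustar).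
  by apply: Rmult_le_compat_l; lra.
have : nu * (4 / nu) * snorm ustar = 4 * snorm ustar by rewrite n4.
have := Rmult_le_pos _ _ (Rlt_le _ _ nu0) r00; have := Rmult_le_pos _ _ (Rlt_le _ _ nu0) u0.
lra.
Qed.

Lemma iterates_consensus k : 'I_n ->
  snorm (fun i => vsub (x k i) (avg (x k)))
  <= beta ^ t k * (snorm (fun i => vsub (y 0%nat i) (ustar i)) + (nu + 4) / nu * snorm ustar).
Proof.
move=> i0; rewrite xE; apply: Rle_trans (snorm_dev_Zpow_le netW (t k) (y k) slemW beta0) _.
by apply: Rmult_le_compat_l (iterates_bounded k i0); exact: pow_le.
Qed.

End step.
End near_dgd.

(** * The recursion for the mean iterate and convergence *)

Theorem theorem3
  (n p : nat) (W : 'I_n -> 'I_n -> R) (beta : R)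
  (f : 'I_n -> vec p -> R) (g : 'I_n -> vec p -> vec p)
  (mu Lc : 'I_n -> R)
  (xstar : vec p) (ustar : stacked n p)
  (alpha : R) (s0 : vec p) (t : nat -> nat)
  (x y : nat -> stacked n p) :
  network_matrix W ->
  is_SLEM W beta -> 0 < beta < 1 ->
  (forall i, has_gradient (f i) (g i)) ->
  (forall i, strongly_convex (mu i) (f i)) ->
  (forall i, 0 < Lc i /\ lipschitz (Lc i) (g i)) ->
  (forall i, is_minimizer (f i) (ustar i)) ->
  is_minimizer (fun z => rsum (fun i => f i z)) xstar ->
  let L := maxR Lc in
  let mubar := / INR n * rsum mu in
  let Lbar := / INR n * rsum Lc in
  let c2 := 2 * mubar * Lbar / (mubar + Lbar) in
  let c4 := 2 / (mubar + Lbar) in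
  let nu := 2 * alpha * minR (fun i => mu i * Lc i / (mu i + Lc i)) in
  0 < alpha -> alpha <= Rmin (/ L) c4 ->
  (* NEAR-DGD+ iterates *)
  (forall i, y 0%nat i = s0) ->
  (forall k, x k = Zpow W (t k) (y k)) ->
  (forall k i, y (S k) i = vsub (x k i) (vscale alpha (g i (x k i)))) ->
  let D := snorm (fun i => vsub (y 0%nat i) (ustar i)) + (nu + 4) / nu * snorm ustar in
  (forall delta, 0 < delta ->
     let c1sq := 1 - alpha * c2 + alpha * delta - alpha ^ 2 * delta * c2 in
     let c3sq := alpha * (alpha + / delta) * D ^ 2 * L ^ 2 in
     forall k,
       (vnorm (vsub (avg (x (S k))) xstar)) ^ 2
         <= c1sq * (vnorm (vsub (avg (x k)) xstar)) ^ 2 + c3sq * beta ^ (2 * t k)) /\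
  (alpha * c2 < 1 ->
   (forall k, (t k < t (S k))%nat) ->
   (forall M : nat, exists K : nat, forall k, (K <= k)%nat -> (M <= t k)%nat) ->
   Un_cv (fun k => vnorm (vsub (avg (x k)) xstar)) 0 /\
   (forall i, Un_cv (fun k => vnorm (vsub (x k i) xstar)) 0)).
Proof.
move=> netW slemW beta01 fg sc lip minu minx L mubar Lbar c2 c4 nu a0 a1 _ xE yE D.
have beta0 : 0 <= beta by lra.
(* An eigenvector has a nonzero entry, so the network has a node [i0]. *)
have [_ [_ [_ [_ [_ [_ [[_ [[i0 _] _]] _]]]]]]] := netW.
(* [mu i <= Lc i] fails to be a consequence of the hypotheses only when [p = 0]. *)
have [j0 _|p0] := pickP (@predT 'I_p); last first.
  have v0 (v : vec p) : vnorm v = 0.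
    by rewrite /vnorm /dot /rsum big_pred0 // sqrt_0.
  have cv0 (v : nat -> vec p) : Un_cv (fun k => vnorm (v k)) 0.
    by move=> eps eps0; exists 0%nat => k _; rewrite v0 /Rdist Rminus_diag Rabs_R0.
  split=> [delta delta0 c1sq c3sq k|_ _ _]; last by split=> [|i]; exact: cv0.
  rewrite !v0; have -> : 0 ^ 2 = 0 by ring.
  have := Rinv_0_lt_compat _ delta0 => id0.
  have : 0 <= c3sq * beta ^ (2 * t k); last by lra.
  apply: Rmult_le_pos (pow_le _ _ beta0).
  apply: Rmult_le_pos (pow2_ge_0 _); apply: Rmult_le_pos (pow2_ge_0 _).
  by apply: Rmult_le_pos; lra.
have fb i : quadratic_bounds (mu i) (Lc i) (f i) (g i).
  move=> u v; split; first exact: strongly_convex_lower.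
  by apply: lipschitz_upper => //; case: (lip i).
have muL i : mu i <= Lc i := quadratic_bounds_le (fb i) j0.
have mu0 i : 0 < mu i by case: (sc i).
have lipg i : lipschitz (Lc i) (g i) by case: (lip i).
have aL : alpha <= / L := Rle_trans _ _ _ a1 (Rmin_l _ _).
have a4 : alpha <= c4 := Rle_trans _ _ _ a1 (Rmin_r _ _).
have cons k : snorm (fun i => vsub (x k i) (avg (x k))) <= beta ^ t k * D.
  exact: (iterates_consensus netW slemW beta0 mu0 muL fb a0 aL minu xE yE k i0).
have rec delta (delta0 : 0 < delta) k :
    vnorm (vsub (avg (x (S k))) xstar) ^ 2
    <= (1 - alpha * c2 + alpha * delta - alpha ^ 2 * delta * c2) * vnorm (vsub (avg (x k)) xstar) ^ 2
       + alpha * (alpha + / delta) * D ^ 2 * L ^ 2 * beta ^ (2 * t k).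
  (* Mixing preserves averages, so [avg (x (S k))] is the average of [y (S k)], one round of local
     gradient steps from [x k]. *)
  rewrite !vnorm_sqr {1 2}xE avg_Zpow //.
  have -> : y (S k) = fun i => vsub (x k i) (vscale alpha (g i (x k i))).
    by apply: functional_extensionality => i; rewrite yE.
  apply: Rle_trans (avg_step_le mu0 muL lipg fb a0 a4 (x k) i0 minx delta0) _.
  apply: Rplus_le_compat_l.
  have id0 := Rinv_0_lt_compat _ delta0.
  have -> : alpha * (alpha + / delta) * D ^ 2 * L ^ 2 * beta ^ (2 * t k) =
      alpha * (alpha + / delta) * L ^ 2 * (beta ^ t k * D) ^ 2.
    by rewrite mulnC (pow_mult _ (t k) 2) Rpow_mult_distr; ring.
  apply: Rmult_le_compat_l.
    by apply: Rmult_le_pos (pow2_ge_0 _); apply: Rmult_le_pos; lra.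
  by apply: pow_incr; split; [exact: snorm_ge0 | exact: cons].
split=> // ac2 _ tinf.
have mub0 : 0 < mubar := mean_gt0 i0 mu0.
have muLb : mubar <= Lbar := mean_le muL.
have c20 : 0 < c2 by apply: Rdiv_lt_0_compat; nra.
have ac0 : 0 < alpha * c2 by exact: Rmult_lt_0_compat.
have cvbar : Un_cv (fun k => vnorm (vsub (avg (x k)) xstar)) 0.
  apply: Un_cv_sqr0.
  (* With [delta = c2] the contraction factor is [1 - (alpha c2)^2]. *)
  apply: (Un_cv_contraction (q := 1 - (alpha * c2) ^ 2)
           (b := fun k => alpha * (alpha + / c2) * D ^ 2 * L ^ 2 * (beta ^ 2) ^ t k)).
  - by split; nra.
  - by move=> k; exact: pow2_ge_0.
  - move=> k; apply: Rle_trans (rec c2 c20 k) _.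
    by apply: Req_le; rewrite (pow_mult _ 2); ring.
  - by apply: Un_cv_pow_comp => //; nra.
(* The error at a node is at most its consensus deviation plus the error of the mean. *)
split=> // i; have cvdev := Un_cv_pow_comp D (conj beta0 (proj2 beta01)) tinf.
have cvsum := CV_plus _ _ _ _ cvdev cvbar; rewrite Rplus_0_l in cvsum.
move=> eps eps0; have [N HN] := cvsum eps eps0; exists N => k kN.
have := HN k kN; rewrite /Rdist !Rminus_0_r => /Rabs_def2[lt _].
rewrite Rabs_pos_eq; last exact: vnorm_ge0.
apply: Rle_lt_trans lt.
have -> : vsub (x k i) xstar = vadd (vsub (x k i) (avg (x k))) (vsub (avg (x k)) xstar).
  by apply: functional_extensionality => j; rewrite /vadd /vsub; ring.
apply: Rle_trans (vnormD _ _) _.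
have := snorm_term (fun i => vsub (x k i) (avg (x k))) i; have := cons k; lra.
Qed.
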